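(* Let $X$ be finite and assume that the conditions $CD(\kappa_0,\infty)$ and $CD_\Upsilon(\kappa,\infty)$ are satisfied with $\kappa_0>\kappa>0$. Let $\pi_0=\min_{x\in X}\pi(x)$ and $|M_1|_\infty=\max_{x\in X}M_1(x)$. Then for any $\varepsilon_0\in(0,1-\frac{\kappa}{\kappa_0})$ there exist constants $h>0$, depending only on $\varepsilon_0,\kappa_0,|M_1|_\infty,\pi_0$, and $C>0$, depending only on $\varepsilon_0,\kappa_0,\kappa,|M_1|_\infty,\pi_0$, such that for any $f\in\mathcal{P}_*^+(X)$ the following holds. (i) If $\mathcal{H}(f)\le h$, then $$\mathcal{H}(P_tf)\le e^{-2(1-\varepsilon_0)\kappa_0t}\,\mathcal{H}(f),\qquad t\ge0.$$ (ii) If $\mathcal{H}(f)>h$, then $$\mathcal{H}(P_tf)\le C\,e^{-2(1-\varepsilon_0)\kappa_0t}\,\mathcal{H}(f)^{\frac{\kappa_0}{\kappa}},\qquad t\ge0.$$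
   Context: Setting ($X$ finite). $k:X\times X\to\mathbb{R}$ are transition rates of a continuous-time Markov chain on $X$: $k(x,y)\ge 0$ for $x\neq y$ and $k(x,x)=-\sum_{y\neq x}k(x,y)<0$. The generator is $Lf(x)=\sum_{y\in X}k(x,y)(f(y)-f(x))$, and $P_t=e^{tL}$ is the associated Markov semigroup. Standing assumptions: the chain is irreducible (for all $x,y\in X$ there are $x=z_1,\dots,z_m=y$, $m\ge2$, with $k(z_i,z_{i+1})>0$); $\mu$ is its invariant probability measure, with density $\pi:X\to(0,\infty)$ with respect to counting measure, and detailed balance $\pi(x)k(x,y)=\pi(y)k(y,x)$ holds. Set $M_1(x):=\sum_{y\neq x}k(x,y)$. $\mathcal{P}_*^+(X)$ is the set of $f:X\to(0,\infty)$ with $\sum_xf(x)\pi(x)=1$ (as $X$ is finite, such $f$ are automatically bounded and bounded away from $0$). Entropy: $\mathcal{H}(\rho)=\sum_x\rho(x)\log(\rho(x))\pi(x)$. Curvature conditions. $\Gamma(f,g)=\frac12(L(fg)-fLg-gLf)$, $\Gamma(f)=\Gamma(f,f)$, $\Gamma_2(f)=\frac12(L\Gamma(f)-2\Gamma(f,Lf))$. $CD(\kappa_0,\infty)$ means $\Gamma_2(f)\ge\kappa_0\Gamma(f)$ on $X$ for all $f:X\to\mathbb{R}$. With $\Upsilon(r)=e^r-1-r$, set $\Psi_\Upsilon(f)(x)=\sum_{y}k(x,y)\Upsilon(f(y)-f(x))$, $B_{\Upsilon'}(f,g)(x)=\sum_y k(x,y)\Upsilon'(f(y)-f(x))(g(y)-g(x))$,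 $\Psi_{2,\Upsilon}(f)=\frac12\big(L\Psi_\Upsilon(f)-B_{\Upsilon'}(f,Lf)\big)$. $CD_\Upsilon(\kappa,\infty)$ means $\Psi_{2,\Upsilon}(f)\ge\kappa\Psi_\Upsilon(f)$ on $X$ for all $f:X\to\mathbb{R}$. *)

(* Defs.v *)
From HB Require Import structures.
From mathcomp Require Import all_boot all_order all_algebra.
From mathcomp Require Import all_classical all_reals all_analysis.
Set Implicit Arguments.
Unset Strict Implicit.
Unset Printing Implicit Defensive.
Import Order.TTheory GRing.Theory Num.Theory.
Import numFieldNormedType.Exports.
Local Open Scope classical_set_scope.
Local Open Scope ring_scope.

Section MarkovChain.
Context {R : realType} {X : finType}.
Implicit Types (k : X -> X -> R) (pi f g : X -> R).

Definition M1 k (x : X) : R := \sum_(y | y != x) k x y.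

Definition transition_rates k : Prop :=
  (forall x y, x != y -> 0 <= k x y) /\
  (forall x, k x x = - M1 k x /\ k x x < 0).

(* The path x = z_1, ..., z_m = y with m >= 2 is x :: s with s nonempty. *)
Definition irreducible_rates k : Prop :=
  forall x y, exists2 s : seq X,
    s != [::] & path (fun a b => 0 < k a b) x s /\ last x s = y.

Definition invariant_density k pi : Prop :=
  [/\ forall x, 0 < pi x, \sum_x pi x = 1
    & forall y, \sum_x pi x * k x y = 0].

Definition detailed_balance k pi : Prop :=
  forall x y, pi x * k x y = pi y * k y x.

(* The default 1 is harmless: the values of a probability density w.r.t.
   counting measure are at most 1. *)
Definition min_density pi : R := \big[Num.min/1]_x pi x.

(* The default 0 is harmless: M1 k is nonnegative for transition rates. *)
Definition max_M1 k : R := \big[Num.max/0]_x M1 k x.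

Definition generator k f (x : X) : R := \sum_y k x y * (f y - f x).

(* e^{tL} as the exponential series; see [is_cvg_semigroup]. *)
Definition semigroup k (t : R) f (x : X) : R :=
  limn (series (fun n => t ^+ n / n`!%:R * iter n (generator k) f x)).

Definition positive_density pi f : Prop :=
  (forall x, 0 < f x) /\ \sum_x f x * pi x = 1.

Definition entropy pi f : R := \sum_x f x * ln (f x) * pi x.

Definition Gamma k f g (x : X) : R :=
  2^-1 * (generator k (fun y => f y * g y) x
          - f x * generator k g x - g x * generator k f x).

Definition Gamma2 k f (x : X) : R :=
  2^-1 * (generator k (Gamma k f f) x - 2 * Gamma k f (generator k f) x).

Definition CD k (kappa : R) : Prop :=
  forall f x, kappa * Gamma k f f x <= Gamma2 k f x.

Definition Upsilon (r : R) : R := expR r - 1 - r.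

Definition Psi k (H : R -> R) f (x : X) : R := \sum_y k x y * H (f y - f x).

Definition Bform k (H : R -> R) f g (x : X) : R :=
  \sum_y k x y * H (f y - f x) * (g y - g x).

Definition Psi2_Upsilon k f (x : X) : R :=
  2^-1 * (generator k (Psi k Upsilon f) x
          - Bform k (derive1 Upsilon) f (generator k f) x).

Definition CD_Upsilon k (kappa : R) : Prop :=
  forall f x, kappa * Psi k Upsilon f x <= Psi2_Upsilon k f x.

Lemma derive1_Upsilon (r : R) : derive1 Upsilon r = expR r - 1.
Proof.
have d : is_derive r (1 : R) Upsilon (expR r - 0 - 1).
  rewrite /Upsilon; apply: is_deriveB.
by rewrite derive1E (@derive_val _ _ _ _ _ _ _ d) subr0.
Qed.

Lemma iter_generator_le k f : exists A F : R, [/\ 0 <= A, 0 <= F &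
  forall n x, `|iter n (generator k) f x| <= A ^+ n * F].
Proof.
pose K := \sum_x \sum_y `|k x y|.
pose F := \sum_x `|f x|.
have K0 : 0 <= K by apply: sumr_ge0 => x _; apply: sumr_ge0.
have F0 : 0 <= F by apply: sumr_ge0.
exists (K * 2), F; split=> //; first by rewrite mulr_ge0.
elim=> [|n IH] x.
  by rewrite expr0 mul1r /= /F (bigD1 x) //= lerDl sumr_ge0.
rewrite iterS exprS /generator.
apply: (le_trans (ler_norm_sum _ _ _)).
have -> : K * 2 * (K * 2) ^+ n * F = K * (2 * ((K * 2) ^+ n * F)).
  by rewrite !mulrA.
have bK : \sum_y `|k x y| <= K.
  by rewrite /K [leRHS](bigD1 x) //= lerDl; apply: sumr_ge0 => z _; apply: sumr_ge0.
have E0 : 0 <= 2 * ((K * 2) ^+ n * F).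
  by rewrite !mulr_ge0 // exprn_ge0 // mulr_ge0.
apply: (le_trans _ (ler_wpM2r E0 bK)).
rewrite mulr_suml; apply: ler_sum => y _.
rewrite normrM ler_wpM2l // mulrDl mul1r.
by apply: (le_trans (ler_normB _ _)); rewrite lerD.
Qed.

Lemma is_cvg_semigroup k (t : R) f x :
  cvgn (series (fun n => t ^+ n / n`!%:R * iter n (generator k) f x)).
Proof.
have [A [F [A0 F0 le]]] := iter_generator_le k f.
apply: normed_cvg.
apply: (@series_le_cvg _ _ (fun n => F * exp_coeff (`|t| * A) n)).
- by move=> n /=.
- by move=> n; rewrite mulr_ge0 // exp_coeff_ge0 // mulr_ge0.
- move=> n; rewrite /= /exp_coeff /= !normrM normfV normrX normr_nat exprMn.
  rewrite [leRHS]mulrC -[leRHS]mulrA mulrAC [leRHS]mulrA.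
  rewrite [X in _ <= X](_ : _ = `|t| ^+ n * (A ^+ n * F) / n`!%:R); last first.
    by rewrite -!mulrA; congr (_ * (_ * _)); rewrite mulrC.
  by rewrite ler_wpM2r ?invr_ge0 // ler_wpM2l ?exprn_ge0.
- have := is_cvg_seriesZ (k := F) (is_cvg_series_exp_coeff (`|t| * A)).
  exact.
Qed.

End MarkovChain.

(* Main.v *)
(** The Dirichlet form E(f, g) = - sum pi f (L g) links the two curvature
    conditions to functional inequalities. Integrated, CD(kappa0) says
    kappa0 E(f, f) <= |L f|^2, which is the Poincare inequality
    kappa0 Var <= E. CD_Upsilon(kappa) says that along the flow the Fisher
    information I = E(log u, u) satisfies I' <= - 2 kappa I; since H' = - I,
    the quantity I - 2 kappa H decreases to a limit that is at least 0, hence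
    2 kappa H <= I everywhere.

    Small entropy forces |f - 1| <= eps0 / 2, because
    x log x - x + 1 >= (sqrt x - 1)^2; there H is close to Var / 2 and I is at
    least E(f, f) / (1 + eps0 / 2), so that the Poincare inequality yields the
    rate 2 (1 - eps0) kappa0. A large entropy decays at rate 2 kappa until
    the time log (H / h) / (2 kappa) at which it must have reached h, and at
    the fast rate afterwards, which gives C = h^(1 - kappa0 / kappa). *)
Require Import Defs.
From HB Require Import structures.
From mathcomp Require Import all_boot all_order all_algebra.
From mathcomp Require Import all_classical all_reals all_analysis.
From mathcomp Require Import ring lra.
Import Order.TTheory GRing.Theory Num.Theory.
Import numFieldNormedType.Exports.
Local Open Scope ring_scope.

(** * One-variable calculus: monotonicity, Gronwall and derivatives *)

Lemma le_of_derive_le0 (R : realType) (F dF : R -> R) (a b : R) :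
  a <= b -> (forall t, a <= t <= b -> is_derive t 1 F (dF t)) ->
  (forall t, a <= t <= b -> dF t <= 0) -> F b <= F a.
Proof.
move=> ab dFE dF0.
have [||c /itvP cab FE] := @MVT_segment R F dF a b ab.
- by move=> t /itvP tab; apply: dFE; rewrite !tab.
- apply: derivable_within_continuous => t /itvP tab.
  by have [] := dFE t; rewrite ?tab.
by rewrite -subr_le0 FE mulr_le0_ge0 ?subr_ge0// dF0 ?cab.
Qed.

(** The function [expR (c * t) * F t] has a nonpositive derivative on the half-line from [a]. *)
Lemma gronwall (R : realType) (F dF : R -> R) (a b c : R) :
  a <= b -> (forall t, a <= t -> is_derive t 1 F (dF t)) ->
  (forall t, a <= t -> dF t <= - c * F t) -> F b <= expR (- c * (b - a)) * F a.
Proof.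
move=> ab dFE dFc.
pose G t := expR (c * t) * F t.
have GE t : a <= t -> is_derive t 1 G (expR (c * t) * (c * F t + dF t)).
  move=> ta; have dFt := dFE t ta.
  have dexp : is_derive t 1 (fun s => expR (c * s)) (expR (c * t) * c).
    apply: (@is_derive1_comp _ expR (fun s => c * s)).
    by apply: is_derive_eq; rewrite /GRing.scale/= mulr1.
  by apply: is_derive_eq; rewrite /GRing.scale/=; ring.
have Gba : G b <= G a.
  apply: (@le_of_derive_le0 _ _ (fun t => expR (c * t) * (c * F t + dF t))) => //.
    by move=> t /andP[+ _]; exact: GE.
  move=> t /andP[ta _]; rewrite pmulr_rle0 ?expR_gt0//.
  by rewrite -lerBrDl sub0r -mulNr dFc.
rewrite -(ler_pM2l (expR_gt0 (c * b))) (le_trans Gba)// mulrA -expRD /G.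
by have -> : c * b + - c * (b - a) = c * a by ring.
Qed.

Lemma is_derive_sum_fin (R : realType) (I : finType) (F : I -> R -> R)
    (dF : I -> R) (t : R) :
  (forall i, is_derive t 1 (F i) (dF i)) ->
  is_derive t 1 (fun s => \sum_i F i s) (\sum_i dF i).
Proof.
move=> dFE; rewrite -fct_sumE.
elim/big_ind2 : _ => [|f df g dg|//]; first exact: is_derive_cst.
exact: is_deriveD.
Qed.

(** A quadratic remainder determines the derivative. This serves for the square of [Num.min y 0],
    where the kink at 0 defeats the product rule. *)
Lemma is_derive_quad (R : realType) (F : R -> R) (x d : R) :
  (forall h, `|F (x + h) - F x - h * d| <= h ^+ 2) -> is_derive x 1 F d.
Proof.
move=> Fx.
suff cvgF : (h^-1 *: (F (h + x) - F x) @[h --> 0^'] --> d)%classic.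
  have E : (fun h : R => h^-1 *: ((F \o shift x) (h *: 1) - F x)) =
           (fun h : R => h^-1 *: (F (h + x) - F x)).
    by apply/funext => h /=; rewrite /GRing.scale/= mulr1.
  split; last by rewrite /derive E; exact: cvg_lim cvgF.
  by rewrite /derivable E; apply/cvg_ex; exists d.
have Fd h : 0 < `|h| < 1 -> `|h^-1 *: (F (h + x) - F x) - d| <= 1 * `|h|.
  move=> /andP[+ _]; rewrite normr_gt0 => h0.
  rewrite mul1r -(ler_pM2l (_ : 0 < `|h|)) ?normr_gt0//.
  rewrite -normrM -expr2 real_normK ?num_real// (le_trans _ (Fx h))//.
  by rewrite /GRing.scale/= mulrBr mulVKf// addrC [h + x]addrC addrC.
by apply/subr_cvg0; exact: (cvg_to_0_linear ltr01 Fd).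
Qed.

(** * The exponential series as a solution of the backward equation *)

Section Semigroup.
Context {R : realType} {X : finType}.
Implicit Types (k : X -> X -> R) (pi f g : X -> R).

(** The generator is a finite sum, so it passes through the limit of the exponential series term by
    term. *)
Lemma semigroup_generator k t f x :
  semigroup k t (generator k f) x = generator k (semigroup k t f) x.
Proof.
apply: cvg_lim => //.
pose a g y n := t ^+ n / n`!%:R * iter n (generator k) g y.
have aE n : a (generator k f) x n = \sum_y k x y * (a f y n - a f x n).
  rewrite /a -iterSr iterS {1}/generator mulr_sumr; apply: eq_bigr => y _.
  ring.
have -> : series (a (generator k f) x) =
    \sum_y (fun n => k x y * (series (a f y) n - series (a f x) n)).
  apply/funext => n; rewrite fct_sumE /series/= (eq_bigr _ (fun i _ => aE i)).
  rewrite exchange_big/=; apply: eq_bigr => y _.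
  by rewrite -mulr_sumr sumrB.
rewrite fct_sumE /generator; apply: cvg_big; first exact: add_continuous.
by move=> y _; apply: cvgMr; apply: cvgB; exact: is_cvg_semigroup.
Qed.

Lemma is_derive_semigroup k (t : R) f (x : X) :
  is_derive t 1 (fun s : R => semigroup k s f x : R)
    (generator k (semigroup k t f) x).
Proof.
pose c g n := n`!%:R^-1 * iter n (generator k) g x.
have cE g s : pseries (c g) s =
    series (fun n => s ^+ n / n`!%:R * iter n (generator k) g x).
  apply/funext => n; apply: eq_bigr => i _ /=.
  by rewrite /c mulrC mulrA.
(* The differentiated coefficient is (n+1) L^(n+1) g / (n+1)! = L^n (L g) / n!: differentiating the
   series amounts to replacing [g] by [L g]. *)
have diffsE g : pseries_diffs (c g) = c (generator k g).
  apply/funext => n; rewrite /pseries_diffs /c -iterSr factS natrM invfM.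
  by rewrite !mulrA divff ?mul1r// pnatr_eq0.
have -> : (fun s => semigroup k s f x) = (fun s => limn (pseries (c f) s)).
  by apply/funext => s; rewrite cE.
rewrite -semigroup_generator /semigroup -cE -diffsE.
(* The series converges everywhere, so any point farther from 0 than [t] can bound the disc of
   convergence. *)
apply: (@pseries_snd_diffs _ _ (`|t| + 1)); rewrite ?diffsE ?cE;
  try exact: is_cvg_semigroup.
by rewrite [ltRHS]ger0_norm ?addr_ge0// ltrDl.
Qed.

Lemma semigroup0 k f x : semigroup k 0 f x = f x.
Proof.
apply: cvg_lim => //; apply: cvg_near_cst; near=> n.
(* The partial sum of index 0 is empty; the value [f x] appears only from index 1 on. *)
have -> : n = n.-1.+1 by rewrite prednK//; near: n; exact: nbhs_infty_gt.
rewrite /series/= big_nat_recl// big1 ?addr0.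
  by rewrite expr0 fact0 divr1 mul1r.
by move=> i _; rewrite expr0n/= !mul0r.
Unshelve. all: by end_near. Qed.

End Semigroup.

(** * Integration by parts under detailed balance, and the Poincare inequality *)

Definition mean {R : realType} {X : finType} (pi f : X -> R) : R :=
  \sum_x f x * pi x.

Definition dirichlet {R : realType} {X : finType} (k : X -> X -> R)
    (pi f g : X -> R) : R :=
  2^-1 * \sum_x \sum_y pi x * k x y * ((f y - f x) * (g y - g x)).

Section Reversible.
Context {R : realType} {X : finType}.
Variables (k : X -> X -> R) (pi : X -> R).
Hypothesis k_rates : transition_rates k.
Hypothesis pi_gt0 : forall x, 0 < pi x.
Hypothesis pi1 : \sum_x pi x = 1.
Hypothesis db : detailed_balance k pi.
Implicit Types f g : X -> R.

Let L := generator k.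
Let E := dirichlet k pi.

Lemma k_ge0 x y : x != y -> 0 <= k x y.
Proof. exact: k_rates.1. Qed.

Lemma mean_cst (c : R) : mean pi (fun=> c) = c.
Proof. by rewrite /mean -mulr_sumr pi1 mulr1. Qed.

Lemma meanZ (c : R) f : mean pi (fun x => c * f x) = c * mean pi f.
Proof. by rewrite /mean mulr_sumr; apply: eq_bigr => x _; rewrite mulrA. Qed.

Lemma meanD f g : mean pi (fun x => f x + g x) = mean pi f + mean pi g.
Proof. by rewrite /mean -big_split; apply: eq_bigr => x _; rewrite mulrDl. Qed.

Lemma meanB f g : mean pi (fun x => f x - g x) = mean pi f - mean pi g.
Proof. by rewrite /mean -sumrB; apply: eq_bigr => x _; rewrite mulrBl. Qed.

Lemma le_mean f g : (forall x, f x <= g x) -> mean pi f <= mean pi g.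
Proof. by move=> fg; apply: ler_sum => x _; rewrite ler_wpM2r// ltW. Qed.

Lemma mean_ge0_eq0 f : (forall x, 0 <= f x) -> mean pi f <= 0 ->
  forall x, f x = 0.
Proof.
move=> f0 mf0 x; have fp0 y : true -> 0 <= f y * pi y.
  by move=> _; rewrite mulr_ge0// ltW.
have : mean pi f = 0 by apply/le_anti; rewrite mf0 sumr_ge0.
move/(psumr_eq0P fp0)/(_ x isT)/eqP.
by rewrite mulf_eq0 (gt_eqF (pi_gt0 x)) orbF => /eqP.
Qed.

Lemma dirichletC f g : E f g = E g f.
Proof.
congr (_ * _); apply: eq_bigr => x _; apply: eq_bigr => y _.
by congr (_ * _); rewrite mulrC.
Qed.

(** Detailed balance makes the weight [pi x * k x y] symmetric, so exchanging [x] and [y]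
    symmetrizes the sum; the two halves account for the factor 1/2 in [dirichlet]. *)
Lemma mean_mul_generator f g : mean pi (fun x => f x * L g x) = - E f g.
Proof.
pose S := \sum_x \sum_y pi x * k x y * (f x * (g y - g x)).
have -> : mean pi (fun x => f x * L g x) = S.
  apply: eq_bigr => x _; rewrite /L /generator mulr_sumr mulr_suml.
  by apply: eq_bigr => y _; ring.
suff -> : E f g = 2^-1 * (- S - S) by field.
have SN : \sum_x \sum_y pi x * k x y * (f y * (g y - g x)) = - S.
  rewrite exchange_big -sumrN; apply: eq_bigr => x _.
  by rewrite -sumrN; apply: eq_bigr => y _; rewrite db; ring.
congr (_ * _); rewrite -{1}SN -sumrB; apply: eq_bigr => x _; rewrite -sumrB.
by apply: eq_bigr => y _; ring.
Qed.

Lemma mean_generator_adj f g :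
  mean pi (fun x => f x * L g x) = mean pi (fun x => L f x * g x).
Proof.
rewrite mean_mul_generator dirichletC -mean_mul_generator.
by apply: eq_bigr => x _; rewrite [g x * _]mulrC.
Qed.

Lemma mean_generator f : mean pi (L f) = 0.
Proof.
have -> : mean pi (L f) = mean pi (fun x => 1 * L f x).
  by apply: eq_bigr => x _; rewrite mul1r.
rewrite mean_mul_generator /E /dirichlet big1 ?mulr0 ?oppr0// => x _.
by rewrite big1// => y _; rewrite subrr mul0r mulr0.
Qed.

Lemma le_dirichlet (c : R) f g f' g' :
  (forall x y,
    (f y - f x) * (g y - g x) <= c * ((f' y - f' x) * (g' y - g' x))) ->
  E f g <= c * E f' g'.
Proof.
move=> le_fg; rewrite /E /dirichlet mulrCA ler_wpM2l ?invr_ge0//.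
rewrite mulr_sumr; apply: ler_sum => x _.
rewrite mulr_sumr; apply: ler_sum => y _; rewrite [leRHS]mulrCA.
(* The diagonal rate is negative, but it multiplies increments that vanish. *)
have [->|xy] := eqVneq x y; first by rewrite !subrr !mul0r !mulr0.
by rewrite ler_wpM2l// mulr_ge0 ?k_ge0// ltW.
Qed.

Lemma dirichlet_ge0 f g :
  (forall x y, 0 <= (f y - f x) * (g y - g x)) -> 0 <= E f g.
Proof.
move=> fg0; rewrite mulr_ge0 ?invr_ge0//.
apply: sumr_ge0 => x _; apply: sumr_ge0 => y _.
have [->|xy] := eqVneq x y; first by rewrite !subrr mul0r mulr0.
by rewrite mulr_ge0// mulr_ge0 ?k_ge0// ltW.
Qed.

Lemma mean_Gamma f : mean pi (Gamma k f f) = E f f.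
Proof.
rewrite /Gamma meanZ !meanB mean_generator mean_mul_generator -/E. 
by field.
Qed.

(** The term [L (Gamma f f)] has mean 0, and self-adjointness turns f L(L f) into the square of L
    f. *)
Lemma mean_Gamma2 f : mean pi (Gamma2 k f) = mean pi (fun x => L f x ^+ 2).
Proof.
rewrite /Gamma2 meanZ meanB mean_generator meanZ /Gamma meanZ !meanB.
rewrite mean_generator mean_generator_adj. by field.
Qed.

Hypothesis k_irr : irreducible_rates k.

(** Zero energy forces equal values across every edge of positive rate, and irreducibility joins any
    two points by such edges. *)
Lemma dirichlet_eq0 f : E f f <= 0 -> forall x y, f x = f y.
Proof.
move=> Ef0.
have term_ge0 x y : 0 <= pi x * k x y * ((f y - f x) * (f y - f x)).
  have [->|xy] := eqVneq x y; first by rewrite subrr mul0r mulr0.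
  by rewrite -expr2 mulr_ge0 ?sqr_ge0// mulr_ge0 ?k_ge0// ltW.
have row_ge0 x : true -> 0 <= \sum_y pi x * k x y * ((f y - f x) * (f y - f x)).
  by move=> _; rewrite sumr_ge0.
have edge x y : 0 < k x y -> f y = f x.
  move=> kxy; move: Ef0; rewrite /E /dirichlet pmulr_rle0 ?invr_gt0// => Ef0.
  have /(psumr_eq0P row_ge0)/(_ x isT) : 
    \sum_x \sum_y pi x * k x y * ((f y - f x) * (f y - f x)) = 0.
    by apply/le_anti; rewrite Ef0 sumr_ge0.
  move=> /(psumr_eq0P (fun y _ => term_ge0 x y))/(_ y isT)/eqP.
  rewrite !mulf_eq0 (gt_eqF (pi_gt0 x)) (gt_eqF kxy)/= orbb subr_eq0.
  by move=> /eqP.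
move=> x y; have [s _ [xs <-]] := k_irr x y.
elim: s x xs => //= z s IH x /andP[/edge <- /IH]; exact.
Qed.

(** Solvability of the Poisson equation lets [poincare] read the integrated curvature condition,
    which concerns L u, as a statement on [f]. *)
Lemma generator_surj f : mean pi f = 0 -> exists u, forall x, L u x = f x.
Proof.
move=> mf0; pose V := {ffun X -> R^o}.
(* Subtracting the mean makes the generator injective, hence onto. *)
pose T (u : V) : V := [ffun x => L u x - mean pi u].
have T_lin : linear T.
  move=> a u v; apply/ffunP => x; rewrite !ffunE /GRing.scale/=.
  have -> : L (a *: u + v) x = a * L u x + L v x.
    rewrite /L /generator mulr_sumr -big_split; apply: eq_bigr => y _ /=.
    by rewrite !ffunE /GRing.scale/=; ring.
  have -> : mean pi (a *: u + v) = a * mean pi u + mean pi v.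
    by rewrite -meanZ -meanD; apply: eq_bigr => y _; rewrite !ffunE.
  by ring.
pose TL : {linear V -> V} := HB.pack T (GRing.isLinear.Build R V V *:%R T T_lin).
have ker0 : lker (linfun TL) == 0%VS.
  apply/lker0P => u v; rewrite !lfunE => Tuv.
  have : T (u - v) = 0 by rewrite (linearB TL u v : T (u - v) = _) Tuv subrr.
  move: (u - v) (subr_eq0 u v) => w wE /ffunP Tw.
  (* L w is constant with mean 0, hence 0; then [w] has no energy, so it is constant and equal to
     its own mean, which is 0. *)
  have Lw x : L w x = mean pi w.
    by have := Tw x; rewrite !ffunE => /eqP; rewrite subr_eq0 => /eqP.
  have mw0 : mean pi w = 0.
    rewrite -[LHS]mean_cst -(mean_generator w).
    by apply: eq_bigr => x _; rewrite -(Lw x).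
  have wcst := @dirichlet_eq0 w.
  apply/eqP; rewrite -wE; apply/eqP/ffunP => x; rewrite ffunE.
  rewrite -[LHS]mean_cst -mw0; apply: eq_bigr => y _; congr (_ * _).
  apply: wcst; rewrite -[E w w]opprK -mean_mul_generator oppr_le0.
  by rewrite /mean big1// => z _; rewrite Lw mw0 mulr0 mul0r.
have [u _ uE] : exists2 u, u \in fullv & finfun f = linfun TL u.
  by apply/memv_imgP; rewrite lker0_limgf ?memvf.
exists u => x.
have {}uE y : f y = L u y - mean pi u.
  by have /ffunP/(_ y) := uE; rewrite lfunE !ffunE.
have mu0 : mean pi u = 0.
  have : mean pi (fun y => L u y - mean pi u) = 0.
    by rewrite -mf0; apply: eq_bigr => y _; rewrite uE.
  by rewrite meanB mean_generator mean_cst sub0r => /eqP; rewrite oppr_eq0 => /eqP.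
by rewrite uE mu0 subr0.
Qed.

Lemma poincare (kappa0 : R) f : 0 < kappa0 -> CD k kappa0 -> mean pi f = 0 ->
  kappa0 * mean pi (fun x => f x ^+ 2) <= E f f.
Proof.
move=> kappa0_gt0 cd /generator_surj[u Luf].
have Eu : kappa0 * E u u <= mean pi (fun x => f x ^+ 2).
  rewrite -mean_Gamma -meanZ (le_trans (le_mean _ _ (cd u)))// mean_Gamma2.
  by apply: le_mean => x; rewrite -Luf.
have Efu : E f u = - mean pi (fun x => f x ^+ 2).
  rewrite -[LHS]opprK -mean_mul_generator; congr (- _).
  by apply: eq_bigr => x _; rewrite Luf.
(* Since L u = f, nonnegativity of E(f + kappa0 u, f + kappa0 u) is enough. *)
have : 0 <= E (fun x => f x + kappa0 * u x) (fun x => f x + kappa0 * u x).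
  by apply: dirichlet_ge0 => x y; rewrite -expr2 sqr_ge0.
have -> : E (fun x => f x + kappa0 * u x) (fun x => f x + kappa0 * u x) =
    E f f + 2 * kappa0 * E f u + kappa0 * (kappa0 * E u u).
  have factor (c A B C : R) : c * A + 2 * kappa0 * (c * B)
      + kappa0 * (kappa0 * (c * C)) =
      c * (A + 2 * kappa0 * B + kappa0 * (kappa0 * C)).
    by ring.
  rewrite /E /dirichlet factor; congr (_ * _).
  rewrite !mulr_sumr -!big_split/=; apply: eq_bigr => x _.
  by rewrite !mulr_sumr -!big_split/=; apply: eq_bigr => y _; ring.
(* With m the mean of f^2, this reads 0 <= E(f, f) - 2 kappa0 m + kappa0 (kappa0 E(u, u)), and [Eu]
   bounds the last term by kappa0 m. *)
rewrite Efu; nra.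
Qed.
End Reversible.

(** * Scalar inequalities for the logarithm and for x log x *)

Section LogInequalities.
Context {R : realType}.
Implicit Types (a b x : R).

Lemma ln_le_subr1 x : 0 < x -> ln x <= x - 1.
Proof.
by move=> x0; rewrite -[X in ln X](subrKC 1) le_ln1Dx// ltrBrDl addrN.
Qed.

Lemma ln_ge_1subV x : 0 < x -> 1 - x^-1 <= ln x.
Proof.
move=> x0; have := @ln_le_subr1 x^-1; rewrite invr_gt0 lnV ?posrE// => /(_ x0).
lra.
Qed.

Lemma subr_ln_le a b : 0 < a -> 0 < b -> (b - a) / b <= ln b - ln a.
Proof.
move=> a0 b0; have := @ln_ge_1subV (b / a).
rewrite ln_div ?posrE// divr_gt0// => /(_ isT); apply: le_trans.
by rewrite invf_div mulrBl divff ?gt_eqF.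
Qed.

Lemma mul_subr_ln_ge0 a b : 0 < a -> 0 < b -> 0 <= (b - a) * (ln b - ln a).
Proof.
move=> a0 b0; have [ab|/ltW ba] := leP a b.
  by rewrite mulr_ge0// subr_ge0// ler_ln ?posrE.
by rewrite mulr_le0// subr_le0// ler_ln ?posrE.
Qed.

(** The logarithmic mean of [a] and [b] is at most their maximum. Summed over edges, this bounds
    E(f, f) by the Fisher information. *)
Lemma sqr_subr_le_mul_ln (M : R) a b : 0 < a <= M -> 0 < b <= M ->
  (b - a) ^+ 2 <= M * ((b - a) * (ln b - ln a)).
Proof.
wlog ab : a b / a <= b => [hwlog aM bM|/andP[a0 aM] /andP[b0 bM]].
  have [/hwlog|/ltW/hwlog] := leP a b; first exact.
  move=> /(_ bM aM); rewrite -sqrrN opprB => /le_trans; apply.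
  by rewrite -[X in _ <= _ * X]mulrNN !opprB.
have : (b - a) * ((b - a) / b) <= (b - a) * (ln b - ln a).
  by rewrite ler_wpM2l ?subr_ge0// subr_ln_le.
rewrite -(ler_pM2l (lt_le_trans b0 bM)); apply: le_trans.
rewrite mulrA -expr2 mulrA ler_pdivlMr// mulrC ler_wpM2r ?sqr_ge0//.
Qed.

Lemma xlnx_ge x : 0 < x -> x - 1 <= x * ln x.
Proof.
move=> x0; have := ln_ge_1subV x x0; rewrite -(ler_pM2l x0); apply: le_trans.
by rewrite mulrBr mulr1 divff ?gt_eqF.
Qed.

Lemma xlnx_le x : 0 < x -> x * ln x - (x - 1) <= (x - 1) ^+ 2.
Proof.
move=> x0; have := ln_le_subr1 x x0; rewrite -(ler_pM2l x0); lra.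
Qed.

(** With s the square root of x, x ln x = 2 s^2 ln s, and ln s >= 1 - 1/s gives the lower bound 2
    s^2 - 2 s. *)
Lemma xlnx_ge_sqrt x : 0 < x -> (Num.sqrt x - 1) ^+ 2 <= x * ln x - (x - 1).
Proof.
move=> x0; have s0 : 0 < Num.sqrt x by rewrite sqrtr_gt0.
have := ln_ge_1subV _ s0; have := sqr_sqrtr (ltW x0).
move: (Num.sqrt x) s0 => s s0 <-.
rewrite expr2 lnM ?posrE// => /(ler_wpM2l (ltW s0)).
rewrite mulrBr mulr1 divff ?gt_eqF// => /(ler_wpM2l (ltW s0)); lra.
Qed.

(** Since |sqrt x - 1| <= d, the factor sqrt x + 1 is at most 2 + d <= 3. *)
Lemma normr_subr1_le (d : R) x : 0 < x -> 0 <= d <= 1 ->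
  x * ln x - (x - 1) <= d ^+ 2 -> `|x - 1| <= 3 * d.
Proof.
move=> x0 /andP[d0 d1] /(le_trans (xlnx_ge_sqrt x x0)).
have := sqrtr_ge0 x; have := sqr_sqrtr (ltW x0).
move: (Num.sqrt x) => s <- s0 sd.
have : `|s - 1| <= d.
  by rewrite -(ler_pXn2r (_ : (0 < 2)%N)) ?nnegrE// real_normK ?num_real.
by rewrite !ler_norml => /andP[? ?]; apply/andP; split; nra.
Qed.

Lemma is_derive_xlnx x : 0 < x ->
  is_derive x 1 (fun y => y * ln y : R) (ln x + 1).
Proof.
move=> x0; have dln := is_derive1_ln x0.
apply: is_derive_eq; rewrite /GRing.scale/= mulr1 divff ?gt_eqF// addrC//.
Qed.

(** A Taylor bound: the second derivative 1/y of the left side is at most 1/c. Concretely, the gap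
    [G] vanishes at 1, falls before 1 and grows after it. *)
Lemma xlnx_le_sqr (c x : R) : 0 < c <= 1 -> c <= x ->
  x * ln x - (x - 1) <= (x - 1) ^+ 2 / (2 * c).
Proof.
move=> /andP[c0 c1] cx.
pose G (y : R) : R := (y - 1) ^+ 2 / (2 * c) - (y * ln y - (y - 1)).
pose dG (y : R) : R := (y - 1) / c - ln y.
have dGE (y : R) : 0 < y -> is_derive y 1 G (dG y).
  move=> y0; have dxlnx := is_derive_xlnx _ y0.
  apply: is_derive_eq; rewrite /GRing.scale/= /dG.
  by field; rewrite gt_eqF.
have G1 : G 1 = 0 by rewrite /G ln1 subrr expr0n/= mul0r mulr0 subrr subrr.
suff : 0 <= G x by rewrite subr_ge0.
rewrite -G1; have [x1|/ltW x1] := leP 1 x.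
  have := @le_of_derive_le0 _ (fun y => - G y) (fun y => - dG y) 1 x x1.
  rewrite lerN2; apply => y /andP[y1 _].
    by apply: is_deriveN; apply: dGE; rewrite (lt_le_trans _ y1).
  rewrite oppr_le0 subr_ge0 (le_trans (ln_le_subr1 y _))//.
    by rewrite (lt_le_trans _ y1).
  by rewrite ler_pdivlMr// ler_piMr// subr_ge0.
apply: (@le_of_derive_le0 _ G dG) => // y /andP[xy y1];
  have y0 : 0 < y by rewrite (lt_le_trans c0)// (le_trans cx).
- exact: dGE.
rewrite subr_le0 (le_trans _ (ln_ge_1subV y y0))//.
have -> : 1 - y^-1 = (y - 1) / y by rewrite mulrBl divff ?gt_eqF// mul1r.
rewrite ler_wnM2l ?subr_le0// lef_pV2 ?posrE//.
exact: le_trans xy.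
Qed.
End LogInequalities.

(** * Derivatives along the flow, positivity, and the entropic form of the curvature condition *)

Definition fisher {R : realType} {X : finType} (k : X -> X -> R)
    (pi f : X -> R) : R := dirichlet k pi (fun x => ln (f x)) f.

Section Flow.
Context {R : realType} {X : finType}.
Variables (k : X -> X -> R) (pi : X -> R).
Hypothesis k_rates : transition_rates k.
Hypothesis pi_gt0 : forall x, 0 < pi x.
Hypothesis pi1 : \sum_x pi x = 1.
Hypothesis db : detailed_balance k pi.
Implicit Types (f g : X -> R) (t : R).

Let L := generator k.
Let E := dirichlet k pi.
Let P t f := semigroup k t f.

Lemma is_derive_mean (F : R -> X -> R) (dF : X -> R) t :
  (forall x, is_derive t 1 (fun s : R => F s x : R) (dF x)) ->
  is_derive t 1 (fun s : R => mean pi (F s) : R) (mean pi dF).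
Proof.
move=> dFE; apply: is_derive_sum_fin => x; have dFx := dFE x.
have -> : (fun s => F s x * pi x) = (fun s => pi x *: F s x).
  by apply/funext => s; rewrite mulrC.
by rewrite mulrC; exact: (is_deriveZ (pi x) dFx).
Qed.

(** The generator commutes with the semigroup, so L (P s f) is itself the orbit of L f. *)
Lemma is_derive_generator_semigroup t f x :
  is_derive t 1 (fun s : R => L (P s f) x : R) (L (L (P t f)) x).
Proof.
have -> : (fun s => L (P s f) x) = (fun s => P s (L f) x).
  by apply/funext => s; rewrite /P semigroup_generator.
have -> : L (L (P t f)) x = L (P t (L f)) x; last exact: is_derive_semigroup.
congr (generator k _ x); apply/funext => y.
by rewrite /P semigroup_generator.
Qed.

Lemma is_derive_mean_semigroup (Phi dPhi : R -> R) t f :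
  (forall x, is_derive (P t f x) 1 Phi (dPhi (P t f x))) ->
  is_derive t 1 (fun s : R => mean pi (fun x => Phi (P s f x)) : R)
    (- E (fun x => dPhi (P t f x)) (P t f)).
Proof.
move=> dPhiE; rewrite -mean_mul_generator//.
apply: is_derive_mean => x.
exact: is_derive1_comp (dPhiE x) (is_derive_semigroup _ _ _ _).
Qed.

Lemma mean_semigroup t f : mean pi (P t f) = mean pi f.
Proof.
have dmean (s : R) : is_derive s 1 (fun s : R => mean pi (P s f) : R) 0.
  rewrite -(mean_generator _ _ db (P s f)).
  by apply: is_derive_mean => x; exact: is_derive_semigroup.
have -> : mean pi (P t f) = mean pi (P 0 f).
  exact: (is_derive_0_is_cst t 0 dmean).
by apply: eq_bigr => x _; rewrite /P semigroup0.
Qed.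

Lemma is_derive_sqr_min (x : R) :
  is_derive x 1 (fun y => Num.min y 0 ^+ 2 : R) (2 * Num.min x 0).
Proof.
apply: is_derive_quad => h; rewrite ler_norml.
have [x0|x0] := leP x 0; have [y0|y0] := leP (x + h) 0; apply/andP; split; nra.
Qed.

(* The quadratic energy of the part of P_t f lying below m does not increase. *)
Lemma semigroup_ge (m : R) t f : (forall x, m <= f x) -> 0 <= t ->
  forall x, m <= P t f x.
Proof.
move=> mf t0.
pose Phi (y : R) : R := Num.min (y - m) 0 ^+ 2.
pose dPhi (y : R) : R := 2 * Num.min (y - m) 0.
have dPhiE (y : R) : is_derive y 1 Phi (dPhi y).
  have dsub : is_derive y 1 (fun z => z - m) 1.
    by apply: is_derive_eq; rewrite subr0.
  rewrite -[dPhi y]mulr1; exact: is_derive1_comp (is_derive_sqr_min _) dsub.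
have : mean pi (fun x => Phi (P t f x)) <= mean pi (fun x => Phi (P 0 f x)).
  apply: (@le_of_derive_le0 _ (fun s : R => mean pi (fun x => Phi (P s f x)) : R)
    (fun s => - E (fun x => dPhi (P s f x)) (P s f))) => // s _.
    exact: is_derive_mean_semigroup.
  (* [dPhi] is nondecreasing, so its increments have the sign of those of P s f. *)
  rewrite oppr_le0; apply: dirichlet_ge0 => // x y.
  rewrite /dPhi/=; move: (P s f x) (P s f y) => a b; have := sqr_ge0 (b - a).
  by have [?|?] := leP (a - m) 0; have [?|?] := leP (b - m) 0; nra.
have -> : mean pi (fun x => Phi (P 0 f x)) = 0.
  rewrite /mean big1// => x _; rewrite /P semigroup0 /Phi.
  by rewrite (min_idPr _) ?subr_ge0// expr0n/= mul0r.
move=> /(mean_ge0_eq0 _ pi_gt0 _ (fun x => sqr_ge0 _)) Phi0 x.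
have /eqP := Phi0 x; rewrite expf_eq0/= => /eqP minE.
by rewrite -subr_ge0 -minE ge_min lexx.
Qed.

Lemma semigroup_gt0 t f : (forall x, 0 < f x) -> 0 <= t -> forall x, 0 < P t f x.
Proof.
move=> f0 t0 x.
(* The default 1 is harmless: any positive lower bound of [f] will do. *)
have m0 : 0 < \big[Num.min/1]_x f x by rewrite lt_bigmin.
by apply: (lt_le_trans m0); apply: semigroup_ge => // y; exact: bigmin_le.
Qed.

Lemma positive_density_semigroup t f : 0 <= t ->
  positive_density pi f -> positive_density pi (P t f).
Proof.
move=> t0 [f0 f1]; split; first exact: semigroup_gt0.
by rewrite -[LHS]/(mean pi (P t f)) mean_semigroup.
Qed.

Lemma is_derive_entropy t f : (forall x, 0 < f x) -> 0 <= t ->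
  is_derive t 1 (fun s : R => entropy pi (P s f) : R) (- fisher k pi (P t f)).
Proof.
move=> f0 t0; have Pf0 := semigroup_gt0 _ _ f0 t0.
(* The constant 1 in the derivative of x log x cancels, as the Dirichlet form sees only
   increments. *)
have -> : fisher k pi (P t f) = E (fun x => ln (P t f x) + 1) (P t f).
  congr (_ * _); apply: eq_bigr => x _; apply: eq_bigr => y _; ring.
apply: (@is_derive_mean_semigroup (fun y => y * ln y) (fun y => ln y + 1)) => x.
exact: is_derive_xlnx.
Qed.

Lemma fisherE f : fisher k pi f = - mean pi (fun x => ln (f x) * L f x).
Proof. by rewrite mean_mul_generator// opprK. Qed.

Lemma is_derive_fisher t f : (forall x, 0 < f x) -> 0 <= t ->
  is_derive t 1 (fun s : R => fisher k pi (P s f) : R)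
   (- mean pi (fun x => L (P t f) x ^+ 2 / P t f x
                        + ln (P t f x) * L (L (P t f)) x)).
Proof.
move=> f0 t0; have Pf0 := semigroup_gt0 _ _ f0 t0.
have -> : (fun s => fisher k pi (P s f)) =
    - (fun s => mean pi (fun x => ln (P s f x) * L (P s f) x)).
  by apply/funext => s; rewrite fisherE.
apply: is_deriveN; apply: is_derive_mean => x.
have dP := is_derive_semigroup k t f x.
have dLP := is_derive_generator_semigroup t f x.
have dln : is_derive t 1 (fun s => ln (P s f x)) ((P t f x)^-1 * L (P t f) x).
  by apply: is_derive1_comp => //; exact: is_derive1_ln.
apply: is_derive_eq; rewrite /GRing.scale/=; ring.
Qed.

Lemma dirichlet_mean f g :
  E f g = 2^-1 * mean pi (fun x => \sum_y k x y * ((f y - f x) * (g y - g x))).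
Proof.
congr (_ * _); apply: eq_bigr => x _; rewrite mulr_suml.
by apply: eq_bigr => y _; ring.
Qed.

(** On logarithms the exponential in [Upsilon] becomes the ratio f y / f x, and the weight [f x]
    clears its denominator. *)
Lemma Psi_Upsilon_ln f x : (forall x, 0 < f x) ->
  f x * Psi k (@Upsilon R) (fun y => ln (f y)) x =
  L f x - f x * L (fun y => ln (f y)) x.
Proof.
move=> f0; rewrite /Psi /L /generator !mulr_sumr -sumrB; apply: eq_bigr => y _.
rewrite /Upsilon expRB !lnK ?posrE//; field.
by rewrite gt_eqF.
Qed.

Lemma mean_Psi_Upsilon f : (forall x, 0 < f x) ->
  mean pi (fun x => f x * Psi k (@Upsilon R) (fun y => ln (f y)) x) =
  fisher k pi f.
Proof.
move=> f0; rewrite (funext (fun x => Psi_Upsilon_ln f x f0)) meanB mean_generator//.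
rewrite mean_mul_generator// sub0r opprK.
by rewrite dirichletC.
Qed.

(** The right side is minus the derivative of the Fisher information along the flow. With
    [mean_Psi_Upsilon], the condition [CD_Upsilon] at ln f, averaged with weight [f], becomes I' <=
    - 2 kappa I. *)
Lemma mean_Psi2_Upsilon f : (forall x, 0 < f x) ->
  2 * mean pi (fun x => f x * Psi2_Upsilon k (fun y => ln (f y)) x) =
  mean pi (fun x => L f x ^+ 2 / f x + ln (f x) * L (L f) x).
Proof.
move=> f0; set lnf := fun y => ln (f y).
(* Multiplying by [f x] turns Upsilon'(ln f y - ln f x) into f y - f x, so this mean is twice the
   energy of f against L (ln f). *)
have BE : mean pi (fun x => f x * Bform k (derive1 (@Upsilon R)) lnf (L lnf) x) =
    - 2 * mean pi (fun x => L f x * L lnf x).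
  have -> : - 2 * mean pi (fun x => L f x * L lnf x) = 2 * E f (L lnf).
    rewrite /E dirichletC -[dirichlet _ _ _ _]opprK -mean_mul_generator//.
    rewrite mulNr mulrN; congr (- (_ * _)); apply: eq_bigr => x _.
    by congr (_ * _); rewrite mulrC.
  rewrite dirichlet_mean mulrA divff// mul1r; apply: eq_bigr => x _.
  congr (_ * _); rewrite /Bform mulr_sumr; apply: eq_bigr => y _.
  rewrite derive1_Upsilon expRB !lnK ?posrE//; field.
  by rewrite gt_eqF.
(* Self-adjointness moves the generator onto [f], after which [Psi_Upsilon_ln] applies pointwise. *)
have LE : mean pi (fun x => f x * L (Psi k (@Upsilon R) lnf) x) =
    mean pi (fun x => L f x ^+ 2 / f x) - mean pi (fun x => L f x * L lnf x).
  rewrite mean_generator_adj// -/L -meanB; apply: eq_bigr => x _; congr (_ * _).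
  have := Psi_Upsilon_ln f x f0 => /(congr1 (fun z => (f x)^-1 * z)).
  rewrite -/lnf mulKf ?gt_eqF// -/L => ->; field.
  by rewrite gt_eqF.
rewrite -meanZ.
have -> : (fun x => 2 * (f x * Psi2_Upsilon k lnf x)) =
    (fun x => f x * L (Psi k (@Upsilon R) lnf) x
              - f x * Bform k (derive1 (@Upsilon R)) lnf (L lnf) x).
  by apply/funext => x; rewrite /Psi2_Upsilon mulrCA mulVKf// mulrBr.
have -> : mean pi (fun x => L f x ^+ 2 / f x + ln (f x) * L (L f) x) =
    mean pi (fun x => L f x ^+ 2 / f x) + mean pi (fun x => L f x * L lnf x).
  rewrite meanD; congr (_ + _); rewrite (mean_generator_adj _ _ db lnf (L f)).
  by apply: eq_bigr => x _; congr (_ * _); rewrite mulrC.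
rewrite meanB BE LE.
ring.
Qed.
End Flow.

(** * Functional inequalities and entropy decay in the two regimes *)

Section EntropyDecay.
Context {R : realType} {X : finType}.
Variables (k : X -> X -> R) (pi : X -> R).
Hypothesis k_rates : transition_rates k.
Hypothesis pi_gt0 : forall x, 0 < pi x.
Hypothesis pi1 : \sum_x pi x = 1.
Hypothesis db : detailed_balance k pi.
Hypothesis k_irr : irreducible_rates k.
Variable kappa0 : R.
Hypothesis kappa0_gt0 : 0 < kappa0.
Hypothesis cd : CD k kappa0.
Implicit Types (f g : X -> R) (t : R).

Let E := dirichlet k pi.
Let P t f := semigroup k t f.
Let variance f := mean pi (fun x => (f x - 1) ^+ 2).

Lemma entropyE f : positive_density pi f ->
  entropy pi f = mean pi (fun x => f x * ln (f x) - (f x - 1)).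
Proof.
move=> [_ f1]; rewrite !meanB mean_cst// (_ : mean pi f = 1)//.
by rewrite subrr subr0.
Qed.

Lemma entropy_ge0 f : positive_density pi f -> 0 <= entropy pi f.
Proof.
move=> fd; rewrite entropyE// -(mean_cst _ pi1 0); apply: le_mean => // x.
by rewrite subr_ge0 xlnx_ge// fd.1.
Qed.

Lemma fisher_ge0 f : (forall x, 0 < f x) -> 0 <= fisher k pi f.
Proof.
move=> f0; apply: dirichlet_ge0 => // x y.
by rewrite mulrC mul_subr_ln_ge0.
Qed.

Lemma poincare_density f : positive_density pi f ->
  kappa0 * variance f <= E (fun x => f x - 1) (fun x => f x - 1).
Proof.
move=> [_ f1]; apply: poincare => //.
by rewrite meanB mean_cst// (_ : mean pi f = 1)// subrr.
Qed.

Lemma variance_semigroup f t : positive_density pi f -> 0 <= t ->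
  variance (P t f) <= expR (- (2 * kappa0) * t) * variance f.
Proof.
move=> fd t0.
have -> : variance f = variance (P 0 f).
  by apply: eq_bigr => x _; rewrite /P semigroup0.
have := @gronwall _ (fun s => variance (P s f))
  (fun s => - E (fun x => 2 * (P s f x - 1)) (P s f)) 0 t (2 * kappa0) t0.
rewrite subr0; apply => s s0.
  apply: (@is_derive_mean_semigroup _ _ _ _ db (fun y => (y - 1) ^+ 2)
    (fun y => 2 * (y - 1))) => x.
  by apply: is_derive_eq; rewrite /GRing.scale/=; ring.
have Pfd : positive_density pi (P s f) by exact: positive_density_semigroup.
rewrite mulNr lerN2 -mulrA.
(* [le_dirichlet] serves as an identity here: the shift by 1 drops out of increments, and 1/2
   absorbs the factor 2. *)
have := poincare_density _ Pfd => /le_trans/(_ (le_dirichlet _ _ _ _ 2^-1 _ _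
  (fun x => 2 * (P s f x - 1)) (P s f) _)).
rewrite ler_pdivlMl//; apply => //.
by move=> x y; rewrite le_eqVlt; apply/orP; left; apply/eqP; field.
Qed.

Lemma entropy_le_variance f : positive_density pi f -> entropy pi f <= variance f.
Proof.
move=> fd; rewrite entropyE//; apply: le_mean => // x.
by rewrite xlnx_le// fd.1.
Qed.

(** If [F] were negative at 0 it would stay below [F 0]; but the Fisher information is nonnegative
    and the entropy, bounded by the variance, tends to 0 by the Poincare inequality. *)
Lemma log_sobolev (kappa : R) f : 0 < kappa -> CD_Upsilon k kappa ->
  positive_density pi f -> 2 * kappa * entropy pi f <= fisher k pi f.
Proof.
move=> kappa_gt0 cdU fd; have f0 := fd.1.
pose D t := mean pi (fun x => generator k (P t f) x ^+ 2 / P t f x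
              + ln (P t f x) * generator k (generator k (P t f)) x).
pose F t := fisher k pi (P t f) - 2 * kappa * entropy pi (P t f).
have F0 : F 0 = fisher k pi f - 2 * kappa * entropy pi f.
  rewrite /F (_ : P 0 f = f)//.
  by apply/funext => x; rewrite /P semigroup0.
have Fdecr t : 0 <= t -> F t <= F 0.
  move=> t0; apply: (@le_of_derive_le0 _ F
      (fun s => - D s + 2 * kappa * fisher k pi (P s f))) => // s /andP[s0 _].
    have dH := is_derive_entropy _ _ k_rates pi_gt0 db _ _ f0 s0.
    have dI := is_derive_fisher _ _ k_rates pi_gt0 db _ _ f0 s0.
    by apply: is_derive_eq; rewrite /GRing.scale/= /D; ring.
  have Pf0 : forall x, 0 < P s f x by exact: semigroup_gt0.
  rewrite addrC subr_le0 /D -mean_Psi2_Upsilon// -mean_Psi_Upsilon// -mulrA.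
  rewrite ler_pM2l// -meanZ; apply: le_mean => // x.
  by rewrite mulrCA ler_wpM2l// ltW.
rewrite -subr_ge0 -F0 leNgt; apply/negP => F0_lt0.
(* The bound expR x >= 1 + x trades exponential decay for linear growth, so that one explicit time
   gives the contradiction without a limit. *)
have F0_le t : 0 <= t -> - F 0 * (1 + 2 * kappa0 * t) <= 2 * kappa * variance f.
  move=> t0; have Pfd := positive_density_semigroup _ _ k_rates pi_gt0 db t f t0 fd.
  have NF0_le : - F 0 <= 2 * kappa * (expR (- (2 * kappa0) * t) * variance f).
    have H_le := le_trans (entropy_le_variance _ Pfd) (variance_semigroup _ _ fd t0).
    apply: le_trans (_ : 2 * kappa * entropy pi (P t f) <= _); last first.
      by rewrite ler_wpM2l// mulr_ge0// ltW.
    have := Fdecr t t0; have := fisher_ge0 _ Pfd.1; rewrite {1}/F; lra.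
  apply: (@le_trans _ _ (- F 0 * expR (2 * kappa0 * t))).
    by rewrite ler_wpM2l ?expR_ge1Dx// oppr_ge0 ltW.
  move: NF0_le; rewrite -(ler_pM2r (expR_gt0 (2 * kappa0 * t))) => /le_trans; apply.
  rewrite mulNr expRN [leLHS](_ : _ = 2 * kappa * variance f)//; field.
  by rewrite gt_eqF ?expR_gt0.
have V0 : 0 <= variance f.
  by rewrite -(mean_cst _ pi1 0); apply: le_mean => // x; exact: sqr_ge0.
have NF0 : 0 < - F 0 by rewrite oppr_gt0.
(* At this time the left side exceeds the right side by exactly [- F 0]. *)
have := F0_le (2 * kappa * variance f / (2 * kappa0 * - F 0)).
have -> : - F 0 * (1 + 2 * kappa0 * (2 * kappa * variance f / (2 * kappa0 * - F 0)))
    = - F 0 + 2 * kappa * variance f.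
  by field; rewrite (lt_eqF F0_lt0) (gt_eqF kappa0_gt0).
rewrite gerDr (lt_geF NF0) => abs; suff: false by [].
by apply: abs; rewrite divr_ge0// ?mulr_ge0// ltW// mulr_gt0.
Qed.

(** All summands of the entropy in the form [entropyE] are nonnegative, so the one at [x], of weight
    at least [min_density pi], obeys the bound alone. The 6 makes 3 (eps0 / 6) equal eps0 / 2. *)
Lemma normr_subr1_of_entropy_le (eps0 : R) f :
  0 < eps0 < 1 -> positive_density pi f ->
  entropy pi f <= min_density pi * (eps0 / 6) ^+ 2 ->
  forall x, `|f x - 1| <= eps0 / 2.
Proof.
move=> /andP[e0 e1] fd fh x.
have p0 : 0 < min_density pi by rewrite lt_bigmin.
have -> : eps0 / 2 = 3 * (eps0 / 6) by field.
apply: normr_subr1_le; first exact: fd.1.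
  by apply/andP; split; lra.
rewrite -(ler_pM2l p0) (le_trans _ fh)// entropyE// /mean (bigD1 x)//= mulrC.
have eta_ge0 y : 0 <= f y * ln (f y) - (f y - 1) by rewrite subr_ge0 xlnx_ge// fd.1.
rewrite ler_wpDr ?ler_wpM2l ?bigmin_le//.
by apply: sumr_ge0 => y _; rewrite mulr_ge0// ltW.
Qed.

Lemma log_sobolev_near (eps0 : R) f : 0 < eps0 < 1 -> positive_density pi f ->
  entropy pi f <= min_density pi * (eps0 / 6) ^+ 2 ->
  2 * (1 - eps0) * kappa0 * entropy pi f <= fisher k pi f.
Proof.
move=> e01 fd fh; have f1 := normr_subr1_of_entropy_le _ _ e01 fd fh.
case/andP: e01 => e0 e1.
have f_itv x : 1 - eps0 / 2 <= f x <= 1 + eps0 / 2.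
  by have := f1 x; rewrite ler_norml => /andP[? ?]; apply/andP; split; lra.
have H_le : entropy pi f <= (2 * (1 - eps0 / 2))^-1 * variance f.
  rewrite entropyE// -meanZ; apply: le_mean => // x; rewrite [leRHS]mulrC.
  apply: xlnx_le_sqr; last by have /andP[] := f_itv x.
  by apply/andP; split; lra.
have fisher_ge :
    E (fun x => f x - 1) (fun x => f x - 1) <= (1 + eps0 / 2) * fisher k pi f.
  apply: le_dirichlet => // x y.
  have -> : f y - 1 - (f x - 1) = f y - f x by ring.
  rewrite [(ln _ - _) * _]mulrC -expr2.
  have /andP[_ fxM] := f_itv x; have /andP[_ fyM] := f_itv y.
  by apply: sqr_subr_le_mul_ln; rewrite fd.1.
have H0 := entropy_ge0 _ fd.
have d0 : 0 < 1 + eps0 / 2 by lra.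
rewrite -(ler_pM2l d0); apply: le_trans fisher_ge.
apply: le_trans (poincare_density _ fd).
move: H_le; rewrite ler_pdivlMl; last lra.
rewrite -(ler_pM2l kappa0_gt0); apply: le_trans.
(* The losses from the two comparisons fit into the rate: 2 (1 - eps0/2) - 2 (1 - eps0) (1 + eps0/2)
   = eps0^2. *)
rewrite -subr_ge0 (_ : _ - _ = eps0 ^+ 2 * (kappa0 * entropy pi f)); last by field.
by rewrite mulr_ge0 ?sqr_ge0// mulr_ge0// ltW.
Qed.

Lemma entropy_decay (c t0 t : R) f : positive_density pi f -> 0 <= t0 <= t ->
  (forall s, t0 <= s -> c * entropy pi (P s f) <= fisher k pi (P s f)) ->
  entropy pi (P t f) <= expR (- c * (t - t0)) * entropy pi (P t0 f).
Proof.
move=> fd /andP[t00 t0t] H_le.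
apply: (@gronwall _ (fun s => entropy pi (P s f))
  (fun s => - fisher k pi (P s f)) _ _ _ t0t) => s s0.
  by apply: is_derive_entropy => //; [exact: fd.1|exact: le_trans s0].
by rewrite mulNr lerN2 H_le.
Qed.

(** Rate 0 in [entropy_decay]. Entropy below the threshold stays there, which keeps
    [log_sobolev_near] available at all later times. *)
Lemma le_entropy_semigroup (s t : R) f : positive_density pi f -> 0 <= s <= t ->
  entropy pi (P t f) <= entropy pi (P s f).
Proof.
move=> fd /andP[s0 st].
have := @entropy_decay 0 s t f fd; rewrite s0 st oppr0 mul0r expR0 mul1r.
apply => // r sr; rewrite mul0r fisher_ge0//.
by apply: semigroup_gt0 => //; [exact: fd.1|exact: le_trans sr].
Qed.

Lemma entropy_decay_near (eps0 t0 t : R) f : 0 < eps0 < 1 ->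
  positive_density pi f -> 0 <= t0 <= t ->
  entropy pi (P t0 f) <= min_density pi * (eps0 / 6) ^+ 2 ->
  entropy pi (P t f)
    <= expR (- (2 * (1 - eps0) * kappa0) * (t - t0)) * entropy pi (P t0 f).
Proof.
move=> e01 fd t0t H_le; apply: entropy_decay => // s t0s.
have /andP[t00 _] := t0t.
apply: log_sobolev_near => //.
  by apply: positive_density_semigroup => //; exact: le_trans t0s.
by apply: le_trans H_le; apply: le_entropy_semigroup; rewrite // t00.
Qed.

Lemma entropy_decay_far (kappa eps0 : R) f :
  0 < kappa < kappa0 -> 0 < eps0 < 1 - kappa / kappa0 ->
  CD_Upsilon k kappa -> positive_density pi f ->
  let h := min_density pi * (eps0 / 6) ^+ 2 in
  h < entropy pi f -> forall t, 0 <= t ->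
  entropy pi (P t f) <= h `^ (1 - kappa0 / kappa) *
    expR (- (2 * (1 - eps0) * kappa0) * t) * entropy pi f `^ (kappa0 / kappa).
Proof.
move=> /andP[k0 kk0] /andP[e0 e1] cdU fd h hH t t0.
(* The upper bound on [eps0] says that the fast rate is at least the slow one. *)
have ek : kappa <= (1 - eps0) * kappa0.
  by rewrite -ler_pdivrMr//; lra.
have {}e1 : eps0 < 1 by rewrite (lt_trans e1)// ltrBlDr ltrDl divr_gt0.
have h0 : 0 < h by rewrite mulr_gt0 ?exprn_gt0 ?divr_gt0// lt_bigmin.
have H0 : 0 < entropy pi f := lt_trans h0 hH.
have decay s : 0 <= s ->
    entropy pi (P s f) <= expR (- (2 * kappa) * s) * entropy pi f.
  move=> s0; have := @entropy_decay (2 * kappa) 0 s f fd.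
  rewrite lexx s0 subr0 (_ : P 0 f = f); last first.
    by apply/funext => x; rewrite /P semigroup0.
  apply => // r r0; apply: log_sobolev => //.
  exact: positive_density_semigroup.
have hm : h = expR (ln h) by rewrite lnK ?posrE.
have Hl : entropy pi f = expR (ln (entropy pi f)) by rewrite lnK ?posrE.
have : ln h <= ln (entropy pi f) by rewrite ler_ln ?posrE// ltW.
(* In terms of m = ln h and l = ln H(f), every bound becomes a linear inequality between
   exponents. *)
rewrite /powR !gt_eqF//; move: (ln h) (ln (entropy pi f)) hm Hl => m l hm Hl ml.
rewrite -!expRD.
pose ts := (l - m) / (2 * kappa).
have ts0 : 0 <= ts by rewrite divr_ge0 ?subr_ge0// mulr_ge0// ltW.
have lm : l - m = 2 * kappa * ts by rewrite /ts; field; rewrite gt_eqF.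
(* The exponent of the target is thus m + 2 kappa0 ts - 2 (1 - eps0) kappa0 t. *)
have lE : kappa0 / kappa * l = kappa0 / kappa * m + 2 * kappa0 * ts.
  by rewrite /ts; field; rewrite gt_eqF.
rewrite lE.
have ekts : 0 <= eps0 * kappa0 * ts by rewrite mulr_ge0// mulr_ge0// ltW.
have [t_ts|/ltW ts_t] := leP t ts.
  apply: le_trans (decay t t0) _; rewrite Hl -expRD ler_expR.
  (* Before [ts] the slow bound has exponent m + 2 kappa (ts - t); it lies below the target by 2
     [gap] + 2 eps0 kappa0 ts. *)
  have gap : 0 <= (ts - t) * ((1 - eps0) * kappa0 - kappa).
    by rewrite mulr_ge0 ?subr_ge0.
  lra.
have H_ts : entropy pi (P ts f) <= h.
  by apply: le_trans (decay ts ts0) _; rewrite hm Hl -expRD ler_expR; lra.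
have near_ts : entropy pi (P t f) <=
    expR (- (2 * (1 - eps0) * kappa0) * (t - ts)) * entropy pi (P ts f).
  by apply: entropy_decay_near => //; [rewrite e0|rewrite ts0].
apply: le_trans near_ts _.
apply: le_trans (ler_wpM2l (expR_ge0 _) H_ts) _.
(* After [ts] the slack in the exponent is 2 eps0 kappa0 ts, nonnegative by [ekts]. *)
rewrite hm -expRD ler_expR; lra.
Qed.
End EntropyDecay.

(** * Choice of the constants and assembly of the two regimes *)

Theorem theorem3p6 (R : realType) :
  exists (h : R -> R -> R -> R -> R) (C : R -> R -> R -> R -> R -> R),
  forall (X : finType) (k : X -> X -> R) (pi : X -> R)
         (kappa0 kappa eps0 : R),
    transition_rates k ->
    irreducible_rates k ->
    invariant_density k pi ->
    detailed_balance k pi ->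
    CD k kappa0 ->
    CD_Upsilon k kappa ->
    0 < kappa < kappa0 ->
    0 < eps0 < 1 - kappa / kappa0 ->
    let h0 := h eps0 kappa0 (max_M1 k) (min_density pi) in
    let C0 := C eps0 kappa0 kappa (max_M1 k) (min_density pi) in
    [/\ 0 < h0, 0 < C0 &
      forall f : X -> R, positive_density pi f ->
        (entropy pi f <= h0 ->
           forall t : R, 0 <= t ->
             entropy pi (semigroup k t f)
               <= expR (- 2 * (1 - eps0) * kappa0 * t) * entropy pi f) /\
        (h0 < entropy pi f ->
           forall t : R, 0 <= t ->
             entropy pi (semigroup k t f)
               <= C0 * expR (- 2 * (1 - eps0) * kappa0 * t)
                  * entropy pi f `^ (kappa0 / kappa))].
Proof.
exists (fun eps0 _ _ pi0 => pi0 * (eps0 / 6) ^+ 2).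
exists (fun eps0 kappa0 kappa _ pi0 =>
  (pi0 * (eps0 / 6) ^+ 2) `^ (1 - kappa0 / kappa)).
move=> X k pi kappa0 kappa eps0 kR kI [pi_gt0 pi1 _] db cd cdU kk0 e01 h0 C0.
have /andP[k_gt0 /(lt_trans k_gt0) k0_gt0] := kk0.
have /andP[e_gt0 e_lt] := e01.
have e_lt1 : eps0 < 1 by rewrite (lt_trans e_lt)// ltrBlDr ltrDl divr_gt0.
have h0_gt0 : 0 < h0.
  by rewrite mulr_gt0 ?exprn_gt0 ?divr_gt0// lt_bigmin.
split => //; first exact: powR_gt0.
have rateE t : - 2 * (1 - eps0) * kappa0 * t = - (2 * (1 - eps0) * kappa0) * t.
  by ring.
move=> f fd; split=> H_h t t_ge0; rewrite rateE; last first.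
  exact: (@entropy_decay_far _ _ _ _ kR pi_gt0 pi1 db kI kappa0).
have P0 : semigroup k 0 f = f by apply/funext => x; rewrite semigroup0.
have := @entropy_decay_near _ _ _ _ kR pi_gt0 pi1 db kI kappa0 k0_gt0 cd eps0 0 t f.
by rewrite e_gt0 e_lt1 lexx t_ge0 subr0 P0; exact.
Qed.
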